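(* Let $G$ and $H$ be graphs. Suppose $A\in\mathcal{S}(G)$ and $B\in\mathcal{S}(H)$ have the SSP. If $\beta$ is a zero forcing cover of the Cartesian product $G\,\square\,H$, then $\beta$ is an SSP liberation set of $A\oplus B$ (viewed as a matrix in $\mathcal{S}(G\,\dot\cup\,H)$).
   Context: All graphs are finite and simple with nonempty vertex set. For a graph $G$ on $n$ vertices, $\mathcal{S}(G)$ is the set of real symmetric $n\times n$ matrices (rows and columns indexed by $V(G)$) whose $(i,j)$-entry, $i\ne j$, is nonzero if and only if $\{i,j\}\in E(G)$; diagonal entries are unconstrained. $\overline{G}$ is the complement of $G$. For $\beta\subseteq E(\overline{G})$, $G+\beta$ is the graph with vertex set $V(G)$ and edge set $E(G)\cup\beta$. $G\,\dot\cup\,H$ is the disjoint union of graphs. $\mathcal{S}_0^{\rm cl}(G)$ is the set of real symmetric matrices with zero diagonal whose $(i,j)$-entry is nonzero only if $\{i,j\}\in E(G)$. $[A,X]=AX-XA$, and $O$ is the zero matrix. For a spanning subgraph $G$ of $H$ and $A\in\mathcal{S}(G)$, $A$ has the SSP with respect to $H$ if $X=O$ is the only symmetric matrix with $X\in\mathcal{S}_0^{\rm cl}(\overline{H})$ and $[A,X]=O$. $A\in\mathcal{S}(G)$ has the SSP (strong spectral property) if it has it with respect to $G$ itself. A nonempty set $\beta\subseteq E(\overline{G})$ is an SSP liberation set of $A\in\mathcal{S}(G)$ if $A$ has the SSP with respect to $G+\beta'$ for all $\beta'\subset\beta$ with $|\beta'|=|\beta|-1$. The Cartesian product $G\,\square\,H$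 has vertex set $V(G)\times V(H)$, with $(u_1,v_1)$ and $(u_2,v_2)$ adjacent iff either $u_1=u_2$ and $\{v_1,v_2\}\in E(H)$, or $v_1=v_2$ and $\{u_1,u_2\}\in E(G)$. A vertex $(u,v)$ of $G\,\square\,H$ is identified with the nonedge $\{u,v\}$ of $G\,\dot\cup\,H$. Zero forcing: given a graph with an initial set $F$ of blue vertices (all others white), the color change rule says that if $v$ is the only white neighbor of a blue vertex $u$, then $v$ turns blue. $F$ is a zero forcing set if repeated application of the rule turns all vertices blue. A nonempty set $F$ of vertices of a graph is a zero forcing cover of the graph if $F'$ is a zero forcing set of it for every $F'\subset F$ with $|F'|=|F|-1$. *)

(* Defs.v *)
From HB Require Import structures.
From mathcomp Require Import all_boot all_order all_algebra.
From mathcomp Require Import reals.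

Set Implicit Arguments.
Unset Strict Implicit.
Unset Printing Implicit Defensive.

Import Order.TTheory GRing.Theory Num.Theory.
Local Open Scope ring_scope.

Record sgraph (V : finType) := SGraph {
  adj :> rel V;
  adj_sym : symmetric adj;
  adj_irr : irreflexive adj }.

Section Graphs.
Variable V : finType.
Implicit Types (G : sgraph V) (F : {set V}).

Definition edges G : {set {set V}} :=
  [set [set p.1; p.2] | p : V * V & G p.1 p.2].

Definition compl_rel G : rel V := fun x y => (x != y) && ~~ G x y.
Lemma compl_sym G : symmetric (compl_rel G).
Proof. by move=> x y; rewrite /compl_rel eq_sym adj_sym. Qed.
Lemma compl_irr G : irreflexive (compl_rel G).
Proof. by move=> x; rewrite /compl_rel eqxx. Qed.
Definition compl_graph G := SGraph (compl_sym G) (compl_irr G).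

(* The guard x != y only discards singletons, which are never elements of a
   set of edges. *)
Definition add_rel G (beta : {set {set V}}) : rel V :=
  fun x y => G x y || ((x != y) && ([set x; y] \in beta)).
Lemma add_sym G beta : symmetric (add_rel G beta).
Proof. by move=> x y; rewrite /add_rel adj_sym eq_sym setUC. Qed.
Lemma add_irr G beta : irreflexive (add_rel G beta).
Proof. by move=> x; rewrite /add_rel adj_irr eqxx. Qed.
Definition add_edges G beta := SGraph (add_sym G beta) (add_irr G beta).

(* One application of the color change rule; the sets are the blue vertices
   before and after it. *)
Definition force_step G : rel {set V} := fun F F' =>
  [exists u in F, exists v,
    ([set w | G u w & w \notin F] == [set v]) && (F' == v |: F)].

Definition zero_forcing_set G F : bool := connect (force_step G) F [set: V].

Definition zero_forcing_cover G F : Prop :=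
  F != set0 /\
  forall F' : {set V}, F' \subset F -> #|F'| = #|F|.-1 ->
    zero_forcing_set G F'.

End Graphs.

Section CartesianProduct.
Variables (V W : finType) (G : sgraph V) (H : sgraph W).

Definition cart_rel : rel (V * W) := fun p q =>
  (p.1 == q.1) && H p.2 q.2 || (p.2 == q.2) && G p.1 q.1.
Lemma cart_sym : symmetric cart_rel.
Proof.
by move=> p q; rewrite /cart_rel (adj_sym G) (adj_sym H) ![q.1 == _]eq_sym
  ![q.2 == _]eq_sym.
Qed.
Lemma cart_irr : irreflexive cart_rel.
Proof. by move=> p; rewrite /cart_rel !adj_irr !andbF. Qed.
Definition cart_prod := SGraph cart_sym cart_irr.
End CartesianProduct.

Section DisjointUnion.
Variables (m n : nat) (G : sgraph 'I_m) (H : sgraph 'I_n).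

(* V(G) is embedded in 'I_(m + n) by lshift n, and V(H) by rshift m. *)
Definition dunion_rel : rel 'I_(m + n) := fun i j =>
  match split i, split j with
  | inl u1, inl u2 => G u1 u2
  | inr v1, inr v2 => H v1 v2
  | _, _ => false
  end.
Lemma dunion_sym : symmetric dunion_rel.
Proof.
move=> i j; rewrite /dunion_rel.
by case: (split i) (split j) => [u|u] [v|v] //; rewrite adj_sym.
Qed.
Lemma dunion_irr : irreflexive dunion_rel.
Proof. by move=> i; rewrite /dunion_rel; case: (split i) => u; rewrite adj_irr. Qed.
Definition dunion := SGraph dunion_sym dunion_irr.
End DisjointUnion.

(* The nonedge {u, v} of the disjoint union that a vertex (u, v) of the
   Cartesian product is identified with. *)
Definition cross_pair (m n : nat) (p : 'I_m * 'I_n) : {set 'I_(m + n)} :=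
  [set lshift n p.1; rshift m p.2].

Section SSP.
Variables (R : realType) (n : nat).
Implicit Types (G H : sgraph 'I_n) (A X : 'M[R]_n).

Definition in_S G A : Prop :=
  A^T = A /\ forall i j, i != j -> (A i j != 0) = G i j.

Definition in_S0cl G A : Prop :=
  [/\ A^T = A, forall i, A i i = 0 & forall i j, A i j != 0 -> G i j].

Definition commutator A X : 'M[R]_n := A *m X - X *m A.

(* Meaningful when A is in S(G) for some spanning subgraph G of H. *)
Definition SSP_wrt H A : Prop :=
  forall X, in_S0cl (compl_graph H) X -> commutator A X = 0 -> X = 0.

Definition has_SSP G A : Prop := in_S G A /\ SSP_wrt G A.

Definition SSP_liberation_set G A (beta : {set {set 'I_n}}) : Prop :=
  [/\ in_S G A, beta != set0, beta \subset edges (compl_graph G) &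
      forall beta' : {set {set 'I_n}},
        beta' \subset beta -> #|beta'| = #|beta|.-1 ->
        SSP_wrt (add_edges G beta') A].

End SSP.

(* Main.v *)
Require Import Defs.
From HB Require Import structures.
From mathcomp Require Import all_boot all_order all_algebra.
From mathcomp Require Import reals.

Set Implicit Arguments.
Unset Strict Implicit.
Unset Printing Implicit Defensive.

Import Order.TTheory GRing.Theory Num.Theory.
Local Open Scope ring_scope.

(** A symmetric [X] commuting with the direct sum of [A] and [B] has diagonal
    blocks commuting with [A] and with [B], and an off-diagonal block [Y] with
    [A Y = Y B].  The SSP of [A] and of [B] kills the diagonal blocks, so
    everything is about [Y], which is a function on the vertices of the
    Cartesian product of [G] and [H].  The entry [(u, v)] of [A Y = Y B] is a
    linear relation between [Y u v] and the values of [Y] at the neighbours of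
    [(u, v)], in which each neighbour has a nonzero coefficient (an
    off-diagonal entry of [A] or of [B]).  Hence if [Y] vanishes at [(u, v)] and
    at all its neighbours but one, it vanishes at the last one too
    ([sylvester_zeros_forced]): the zeros of [Y] obey the color change rule.
    If the zeros contain a zero forcing set, then [Y = 0].

    Finally, the nonedges of the disjoint union that are added to the graph are
    positions where [X] must vanish, so removing one element from the cover
    still leaves [Y] with a zero forcing set of zeros. *)

(** Forcing is monotone in the blue set: a vertex forced by a subset of [Z] is
    also forced by [Z], unless it already lies in [Z].  So the hypothesis need
    only speak of the rule with [Z] itself as the set of blue vertices. *)
Lemma zero_forcing_closed (V : finType) (G : sgraph V) (F : {set V})
    (Z : pred V) :
  (forall u v, Z u -> G u v -> (forall w, G u w -> w != v -> Z w) -> Z v) ->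
  {subset F <= Z} -> zero_forcing_set G F -> forall x, Z x.
Proof.
move=> Zforce FZ /connectP[s]; elim: s F FZ => [|F1 s IHs] F FZ /=.
  by move=> _ defF x; apply: FZ; rewrite -defF inE.
case/andP=> /exists_inP[u uF /existsP[v /andP[/eqP uv /eqP defF1]]].
apply: IHs => x; rewrite {F1}defF1 !inE => /predU1P[->|]; last exact: FZ.
have: v \in [set w | G u w & w \notin F] by rewrite uv set11.
rewrite inE => /andP[Guv _]; apply: (Zforce u) => // [|w Guw wv].
  exact: FZ.
apply: FZ; apply: contraR wv => wF.
by rewrite -in_set1 -uv inE Guw.
Qed.

Lemma in_S_sum_supp (R : realType) (n : nat) (G : sgraph 'I_n) (A : 'M[R]_n)
    (y : 'I_n -> R) (i j : 'I_n) :
  in_S G A -> (forall k, k != j -> (k == i) || G i k -> y k = 0) ->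
  \sum_k A i k * y k = A i j * y j.
Proof.
case=> _ AG y0; rewrite (bigD1 j) //= big1 ?addr0 // => k kj.
have [/(y0 k kj)->|] := boolP ((k == i) || G i k); first by rewrite mulr0.
rewrite negb_or eq_sym => /andP[/AG <- /negbNE/eqP->].
exact: mul0r.
Qed.

(** The color change rule for the zeros of a solution of the Sylvester equation
    [A Y = Y B].  A forced neighbour [q] of [p] differs from [p] in exactly one
    coordinate, so at entry [p] one side of the equation is zero and the other
    reduces to the single term of [q]. *)
Lemma sylvester_zeros_forced (R : realType) (m n : nat) (G : sgraph 'I_m)
    (H : sgraph 'I_n) (A : 'M[R]_m) (B : 'M[R]_n) (Y : 'M[R]_(m, n))
    (p q : 'I_m * 'I_n) :
  in_S G A -> in_S H B -> A *m Y = Y *m B ->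
  Y p.1 p.2 = 0 -> cart_prod G H p q ->
  (forall r, cart_prod G H p r -> r != q -> Y r.1 r.2 = 0) ->
  Y q.1 q.2 = 0.
Proof.
case: p q => [u v] [u' v'] /= AS BS eqY Yuv pq Y0.
have BT l : B l v = B v l by rewrite -{1}BS.1 mxE.
have entry : \sum_k A u k * Y k v = \sum_l B v l * Y u l.
  move/matrixP/(_ u v): eqY; rewrite !mxE => ->.
  by apply: eq_bigr => l _; rewrite BT mulrC.
have YG k : G u k -> (k, v) != (u', v') -> Y k v = 0.
  by move=> Guk; apply: Y0; rewrite /cart_rel /= eqxx Guk orbT.
have YH l : H v l -> (u, l) != (u', v') -> Y u l = 0.
  by move=> Hvl; apply: Y0; rewrite /cart_rel /= eqxx Hvl.
case/orP: pq => /= /andP[/eqP def adjq].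
- subst u'.
  move: entry; rewrite (in_S_sum_supp (j := u) AS) => [|k ku].
    rewrite (in_S_sum_supp (j := v') BS) => [|l lv' /predU1P[->//|]].
      rewrite Yuv mulr0 => /esym/eqP; rewrite mulf_eq0 => /predU1P[Bvv'|/eqP//].
      have vv' : v != v' by apply: contraTneq adjq => ->; rewrite adj_irr.
      by rewrite -(BS.2 _ _ vv') Bvv' eqxx in adjq.
    by move/YH; apply; rewrite xpair_eqE (negPf lv') andbF.
  rewrite (negPf ku) => /YG; apply.
  by rewrite xpair_eqE (negPf ku).
- subst v'.
  move: entry; rewrite [RHS](in_S_sum_supp (j := v) BS) => [|l lv].
    rewrite (in_S_sum_supp (j := u') AS) => [|k ku' /predU1P[->//|]].
      rewrite Yuv mulr0 => /eqP; rewrite mulf_eq0 => /predU1P[Auu'|/eqP//].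
      have uu' : u != u' by apply: contraTneq adjq => ->; rewrite adj_irr.
      by rewrite -(AS.2 _ _ uu') Auu' eqxx in adjq.
    by move/YG; apply; rewrite xpair_eqE (negPf ku').
  rewrite (negPf lv) => /YH; apply.
  by rewrite xpair_eqE (negPf lv) andbF.
Qed.

Lemma sylvester_zero_forcing (R : realType) (m n : nat) (G : sgraph 'I_m)
    (H : sgraph 'I_n) (A : 'M[R]_m) (B : 'M[R]_n) (Y : 'M[R]_(m, n))
    (F : {set 'I_m * 'I_n}) :
  in_S G A -> in_S H B -> A *m Y = Y *m B ->
  zero_forcing_set (cart_prod G H) F -> {in F, forall p, Y p.1 p.2 = 0} ->
  Y = 0.
Proof.
move=> AS BS eqY Fzf Y0; apply/matrixP=> i j; rewrite mxE.
pose Z := [pred p : 'I_m * 'I_n | Y p.1 p.2 == 0].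
apply/eqP; apply: (@zero_forcing_closed _ _ F Z _ _ Fzf (i, j)).
- move=> p q /eqP Yp pq Ynb; apply/eqP.
  apply: sylvester_zeros_forced AS BS eqY Yp pq _ => r pr rq.
  exact/eqP/Ynb.
- by move=> p /Y0/eqP.
Qed.

Section DirectSum.
Variables (R : realType) (m n : nat) (G : sgraph 'I_m) (H : sgraph 'I_n).

Lemma dunionE : (forall i j, dunion G H (lshift n i) (lshift n j) = G i j)
  * (forall i j, dunion G H (rshift m i) (rshift m j) = H i j)
  * (forall i j, dunion G H (lshift n i) (rshift m j) = false)
  * (forall i j, dunion G H (rshift m i) (lshift n j) = false).
Proof.
have L i : split (lshift n i) = inl i :> 'I_m + 'I_n := unsplitK (inl i).
have Rr i : split (rshift m i) = inr i :> 'I_m + 'I_n := unsplitK (inr i).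
by split; [split; [split|]|]; move=> i j; rewrite /= /dunion_rel ?L ?Rr.
Qed.

Lemma in_S_dsum (A : 'M[R]_m) (B : 'M[R]_n) :
  in_S G A -> in_S H B -> in_S (dunion G H) (block_mx A 0 0 B).
Proof.
move=> [AT AG] [BT BH]; split; first by rewrite tr_block_mx AT BT !trmx0.
move=> i j; case: (split_ordP i) => {}i ->; case: (split_ordP j) => {}j ->.
- by rewrite (inj_eq (@lshift_inj _ _)) block_mxEul dunionE => /AG.
- by rewrite block_mxEur dunionE mxE eqxx.
- by rewrite block_mxEdl dunionE mxE eqxx.
- by rewrite (inj_eq (@rshift_inj _ _)) block_mxEdr dunionE => /BH.
Qed.

Lemma cross_pair_inj : injective (@cross_pair m n).
Proof.
move=> [u v] [u' v'] /setP eqs.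
have := eqs (lshift n u); have := eqs (rshift m v).
rewrite !inE /= !eqxx !eq_lshift !eq_rshift !eq_lrshift !eq_rlshift !orbT !orbF /=.
by move=> /esym/eqP-> /esym/eqP->.
Qed.

Lemma cross_pair_nonedge p :
  cross_pair p \in edges (compl_graph (dunion G H)).
Proof.
apply/imsetP; exists (lshift n p.1, rshift m p.2) => //.
by rewrite inE /= /compl_rel eq_lrshift dunionE.
Qed.

(** A zero forcing set [F] is all it takes to get the SSP with respect to one
    supergraph; a zero forcing cover supplies such an [F] each time one of its
    vertices is removed. *)
Lemma SSP_wrt_dsum (A : 'M[R]_m) (B : 'M[R]_n) (F : {set 'I_m * 'I_n}) :
  has_SSP G A -> has_SSP H B -> zero_forcing_set (cart_prod G H) F ->
  SSP_wrt (add_edges (dunion G H) [set cross_pair p | p in F])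
    (block_mx A 0 0 B).
Proof.
move=> [AS Assp] [BS Bssp] Fzf X [XT Xdiag Xsupp].
have XnG i j : X i j != 0 -> (i != j) && ~~ dunion G H i j.
  by move=> /Xsupp /andP[-> /norP[]].
have Xcross p : p \in F -> X (lshift n p.1) (rshift m p.2) = 0.
  move=> pF; apply/eqP/negPn/negP => /Xsupp /andP[_ /norP[_]].
  by rewrite eq_lrshift /= => /negP[]; apply/imsetP; exists p.
rewrite /commutator -{1 2}(submxK X) !mulmx_block !mul0mx !mulmx0 !addr0 !add0r.
move/eqP; rewrite subr_eq0 => /eqP /eq_block_mx[eqA eqY _ eqB].
have X1 : ulsubmx X = 0.
  apply: Assp; last by rewrite /commutator eqA subrr.
  split=> [|i|i j]; first by rewrite trmx_ulsub XT.
    by rewrite !mxE Xdiag.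
  by rewrite !mxE => /XnG; rewrite eq_lshift dunionE.
have X2 : drsubmx X = 0.
  apply: Bssp; last by rewrite /commutator eqB subrr.
  split=> [|i|i j]; first by rewrite trmx_drsub XT.
    by rewrite !mxE Xdiag.
  by rewrite !mxE => /XnG; rewrite eq_rshift dunionE.
have Y0 : ursubmx X = 0.
  apply: sylvester_zero_forcing AS BS eqY Fzf _ => p pF.
  by rewrite !mxE Xcross.
have Y0' : dlsubmx X = 0 by rewrite -XT -trmx_ursub Y0 trmx0.
by rewrite -[X]submxK X1 X2 Y0 Y0' block_mx0.
Qed.

End DirectSum.

Theorem theorem4p4 (R : realType) (m n : nat) (hm : (0 < m)%N) (hn : (0 < n)%N)
    (G : sgraph 'I_m) (H : sgraph 'I_n) (A : 'M[R]_m) (B : 'M[R]_n)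
    (hA : has_SSP G A) (hB : has_SSP H B)
    (beta : {set 'I_m * 'I_n})
    (hbeta : zero_forcing_cover (cart_prod G H) beta) :
  SSP_liberation_set (dunion G H) (block_mx A 0 0 B)
    [set cross_pair p | p in beta].
Proof.
case: hbeta => beta0 betaF; split.
- exact: in_S_dsum hA.1 hB.1.
- by rewrite imset_eq0.
- by apply/subsetP=> _ /imsetP[p _ ->]; apply: cross_pair_nonedge.
move=> beta' sbeta.
pose F := [set p in beta | cross_pair p \in beta'].
have -> : beta' = [set cross_pair p | p in F].
  apply/setP=> e; apply/idP/imsetP=> [e'|[p]]; last first.
    by rewrite inE => /andP[_ ep] ->.
  have /imsetP[p pb def_e] := subsetP sbeta e e'.
  by exists p; rewrite // inE pb -def_e.
rewrite !card_imset; try exact: cross_pair_inj.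
move=> cF; apply: SSP_wrt_dsum => //; apply: betaF cF.
by apply/subsetP=> p; rewrite inE => /andP[].
Qed.
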